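(* Let $\mathbf a,\mathbf b,\mathbf c$ be three distinct non-collinear oriented cycles. Let $\mathbf n_a\in\mathcal G(\mathbf b,\mathbf c)$, $\mathbf n_b\in\mathcal G(\mathbf a,\mathbf c)$, $\mathbf n_c\in\mathcal G(\mathbf a,\mathbf b)$ be three generalized cycles distinct from $\mathbf a,\mathbf b,\mathbf c$. Then the extended pencils $\mathcal G(\mathbf a,\mathbf n_a)$, $\mathcal G(\mathbf b,\mathbf n_b)$, $\mathcal G(\mathbf c,\mathbf n_c)$ are concurrent if and only if $$(\mathbf b,\mathbf c;\mathbf n_a)\,(\mathbf c,\mathbf a;\mathbf n_b)\,(\mathbf a,\mathbf b;\mathbf n_c)=-1.$$ Moreover, if $\mathbf n$ is the common generalized cycle of these three pencils and $\mathbf n_a$ is elliptic (with any chosen orientation), then $$(\mathbf a,\mathbf n_a;\mathbf n)=(\mathbf b,\mathbf n_a;\mathbf c)\,(\mathbf a,\mathbf b;\mathbf n_c).$$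
   Context: The Möbius plane is $\mathbb C\cup\{\infty\}$. A (non-oriented) cycle is the solution set of $kz\bar z+lz+m\bar z+n=0$ with $M=\left(\begin{smallmatrix} k & l \\ m & n \end{smallmatrix}\right)$ a $2\times2$ Hermitian matrix of negative determinant, i.e. a Euclidean circle or a straight line with $\infty$ attached; $M$ is determined up to a nonzero real factor. An oriented cycle corresponds to a unique normalized Hermitian matrix $M$ with $\det M=-1$, the sign being chosen so that the left half-plane of the oriented cycle is $\{kz\bar z+lz+m\bar z+n<0\}$; reversing orientation replaces $M$ by $-M$. A generalized cycle is a nonzero $2\times2$ Hermitian matrix considered up to a nonzero real factor. It is elliptic (an ordinary cycle) if its determinant is negative, parabolic if the determinant is zero, hyperbolic (virtual) if the determinant is positive. Oriented cycles are identified with their underlying generalized cycles when orientation is irrelevant. For two generalized cycles that are distinct (non-proportional matrices $M,N$), the extended pencil $\mathcal G(\cdot,\cdot)$ they define is the set of all generalized cycles with matrix $xM+yN$, $(x,y)\in\mathbb R^2\setminus\{0\}$. Three generalized cycles are collinear if they belong to one extended pencil, i.e. their matrices are linearly dependent over $\mathbb R$. Three extended pencils are concurrent if they share a common generalized cycle. Splitting factor: let $\mathbf p,\mathbf q$ be oriented (elliptic) cycles with distinct underlying cycles and normalized matrices $M,N$, and let $\mathbf r\in\mathcal G(\mathbf p,\mathbf q)$. Then $(\mathbf p,\mathbf q;\mathbf r)$ is the unique $\lambda\in\mathbb R\cup\{\infty\}$ such that $\mathbf r$ is represented by $M-\lambda N$ ($\lambda=\infty$ iff $\mathbf r$ and $\mathbf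 q$ are the same cycle). *)

(* Defs.v *)
From HB Require Import structures.
From mathcomp Require Import all_boot all_order all_algebra.
From mathcomp Require Import boolp classical_sets reals complex.
From mathcomp Require Import generic_quotient sesquilinear.

Set Implicit Arguments.
Unset Strict Implicit.
Unset Printing Implicit Defensive.

Import Order.TTheory GRing.Theory Num.Theory.

Local Open Scope ring_scope.
Local Open Scope complex_scope.
Local Open Scope classical_set_scope.
Local Open Scope quotient_scope.

(* Nonzero 2 x 2 Hermitian matrices; M = (k, l; m, n) stands for the equation
   k z z^* + l z + m z^* + n = 0 on the Moebius plane. *)
Record hermmx (R : realType) := HermMx {
  hmx : 'M[R[i]]_2;
  hmxP : (hmx \is hermsymmx) && (hmx != 0) }.

HB.instance Definition _ (R : realType) := [isSub for @hmx R].
HB.instance Definition _ (R : realType) := [Choice of hermmx R by <:].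

Definition proportional (R : realType) : rel (hermmx R) := fun M N =>
  `[< exists2 t : R, t != 0 & hmx M = t%:C *: hmx N >].

Lemma real_complex_neq0 (R : realType) (t : R) : (t%:C != 0) = (t != 0).
Proof. by rewrite fmorph_eq0. Qed.

Lemma proportional_refl (R : realType) : reflexive (@proportional R).
Proof. by move=> M; apply/asboolP; exists 1; rewrite ?oner_neq0 ?scale1r. Qed.

Lemma proportional_sym (R : realType) : symmetric (@proportional R).
Proof.
suff H M N : @proportional R M N -> proportional N M.
  by move=> M N; apply/idP/idP; exact: H.
move=> /asboolP[t t0 MN]; apply/asboolP; exists t^-1; rewrite ?invr_neq0//.
by rewrite MN scalerA -rmorphM mulVf// scale1r.
Qed.

Lemma proportional_trans (R : realType) : transitive (@proportional R).
Proof.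
move=> N M P /asboolP[t t0 MN] /asboolP[s s0 NP]; apply/asboolP.
by exists (t * s); rewrite ?mulf_neq0// MN NP scalerA -rmorphM.
Qed.

Canonical proportional_equiv (R : realType) :=
  EquivRel (@proportional R) (@proportional_refl R) (@proportional_sym R)
    (@proportional_trans R).

(* A generalized cycle is a nonzero Hermitian matrix up to a nonzero real
   factor; equality of generalized cycles is Leibniz equality in this quotient. *)
Definition gcycle (R : realType) : Type := {eq_quot (@proportional R)}.

Definition represents (R : realType) (M : 'M[R[i]]_2) (r : gcycle R) : Prop :=
  exists2 H : hermmx R, hmx H = M & r = \pi_({eq_quot (@proportional R)}) H.

(* The order of R[i] is the partial one: [z < 0] means that z is real and
   negative. Determinants of Hermitian matrices are real. *)
Definition elliptic (R : realType) (r : gcycle R) : Prop :=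
  exists2 M : 'M[R[i]]_2, represents M r & \det M < 0.

(* An oriented cycle is given by its normalized Hermitian matrix, whose sign
   records the orientation (the left half-plane is where the equation is
   negative). *)
Record ocycle (R : realType) := OCycle {
  omx : 'M[R[i]]_2;
  omx_herm : omx \is hermsymmx;
  omx_det : \det omx = -1 }.

Lemma omx_subproof (R : realType) (p : ocycle R) :
  (omx p \is hermsymmx) && (omx p != 0).
Proof.
rewrite omx_herm; apply: contra_eq_neq (omx_det p) => ->.
by rewrite det0 eq_sym oppr_eq0 oner_neq0.
Qed.

Definition underlying (R : realType) (p : ocycle R) : gcycle R :=
  \pi_({eq_quot (@proportional R)}) (HermMx (omx_subproof p)).
Coercion underlying : ocycle >-> gcycle.

(* Intended for distinct p and q. *)
Definition pencil (R : realType) (p q : gcycle R) : set (gcycle R) :=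
  [set r | exists (M N : 'M[R[i]]_2) (x y : R),
    [/\ represents M p, represents N q, (x, y) != (0, 0)
      & represents (x%:C *: M + y%:C *: N) r]].

Definition collinear (R : realType) (p q r : gcycle R) : Prop :=
  exists u v : gcycle R,
    [/\ u <> v, pencil u v p, pencil u v q & pencil u v r].

Definition concurrent (R : realType) (G1 G2 G3 : set (gcycle R)) : Prop :=
  exists n : gcycle R, [/\ G1 n, G2 n & G3 n].

(* [option R] is the real projective line, [None] being the point at infinity. *)
Definition is_splitting_factor (R : realType) (p q : ocycle R) (r : gcycle R)
    (l : option R) : Prop :=
  match l with
  | Some l => represents (omx p - l%:C *: omx q) r
  | None => r = q
  end.

(* The junk value [None] is only taken if no l is suitable, which does not
   occur for distinct p, q and r in their pencil (see splitting_factor_def). *)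
Definition splitting_factor (R : realType) (p q : ocycle R) (r : gcycle R) :
    option R :=
  xget None [set l | is_splitting_factor p q r l].

(* infinity is absorbing; the indeterminate 0 * infinity is never used *)
Definition pmul (R : realType) (x y : option R) : option R :=
  match x, y with
  | Some a, Some b => Some (a * b)
  | _, _ => None
  end.

Lemma represents_inj (R : realType) (M N : 'M[R[i]]_2) (r : gcycle R) :
  represents M r -> represents N r -> exists2 t : R, t != 0 & M = t%:C *: N.
Proof.
move=> [H <- ->] [K <-] /eqmodP /asboolP; exact.
Qed.

Lemma represents_scale (R : realType) (M : 'M[R[i]]_2) (r : gcycle R) (t : R) :
  t != 0 -> represents M r -> represents (t%:C *: M) r.
Proof.
move=> t0 [H <- ->].
have HP : (t%:C *: hmx H \is hermsymmx) && (t%:C *: hmx H != 0).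
  have /andP[] := hmxP H; rewrite !qualifE/= expr0 !scale1r => /eqP Hh H0.
  rewrite scaler_eq0 negb_or real_complex_neq0 t0 H0 andbT.
  rewrite linearZ/= map_mxZ -Hh andbT; apply/eqP; congr (_ *: _).
  by apply/esym/CrealP; rewrite complex_real.
exists (HermMx HP) => //; apply/eqmodP/asboolP.
by exists t^-1; rewrite ?invr_neq0//= scalerA -rmorphM mulVf// scale1r.
Qed.

Lemma represents_eq (R : realType) (M : 'M[R[i]]_2) (r s : gcycle R) :
  represents M r -> represents M s -> r = s.
Proof.
move=> [H HM ->] [K KM ->]; apply/eqmodP/asboolP; exists 1.
  by rewrite oner_neq0.
by rewrite HM KM scale1r.
Qed.

Lemma represents_omx (R : realType) (p : ocycle R) :
  represents (omx p) (underlying p).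
Proof. by exists (HermMx (omx_subproof p)). Qed.

Lemma omx_proportional (R : realType) (p q : ocycle R) (t : R) :
  omx p = t%:C *: omx q -> underlying p = underlying q.
Proof.
move=> pq; have [t0|t0] := eqVneq t 0.
  by have /andP[_] := omx_subproof p; rewrite pq t0 scale0r eqxx.
apply: (represents_eq (represents_omx p)); rewrite pq.
exact: represents_scale (represents_omx q).
Qed.

Lemma splitting_factor_unique (R : realType) (p q : ocycle R) (r : gcycle R) :
  underlying p <> underlying q -> pencil p q r ->
  exists! l, is_splitting_factor p q r l.
Proof.
move=> pq [M [N [x [y [Mp Nq xy rr]]]]].
have [s s0 Ms] := represents_inj Mp (represents_omx p).
have [t t0 Nt] := represents_inj Nq (represents_omx q).
have q0 : omx q != 0 by have /andP[] := omx_subproof q.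
have noSN l : represents (omx p - l%:C *: omx q) r -> r <> underlying q.
  move=> + rq; rewrite rq => rl.
  have [u u0] := represents_inj rl (represents_omx q).
  move=> /eqP; rewrite subr_eq -scalerDl -rmorphD => /eqP.
  by move/omx_proportional.
rewrite {}Ms {}Nt !scalerA -!rmorphM in rr.
have ex : exists l, is_splitting_factor p q r l.
  have [x0|x0] := eqVneq x 0.
    have y0 : y != 0 by apply: contra xy => /eqP ->; rewrite x0.
    rewrite x0 mul0r scale0r add0r in rr; exists None => /=.
    apply: (represents_eq rr).
    by apply: represents_scale (represents_omx q); rewrite mulf_neq0.
  exists (Some (- ((x * s)^-1 * (y * t)))) => /=.
  have xs0 : x * s != 0 by rewrite mulf_neq0.
  have := represents_scale (invr_neq0 xs0) rr.
  by rewrite scalerDr !scalerA -!rmorphM mulVf// scale1r rmorphN scaleNr opprK.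
have [l lP] := ex; exists l; split=> // l'.
case: l lP => [l|] /= lP; case: l' => [l'|] //= lP'.
- have [u u0 /eqP e] := represents_inj lP lP'.
  have [u1|u1] := eqVneq u 1.
    move: e; rewrite u1 scale1r (inj_eq (addrI _)) eqr_opp -subr_eq0 -scalerBl.
    by rewrite scaler_eq0 (negPf q0) orbF subr_eq0 => /eqP/complexI ->.
  exfalso; apply: pq; apply: (@omx_proportional _ _ _ ((1 - u)^-1 * (l - u * l'))).
  have u1' : 1 - u != 0 by rewrite subr_eq0 eq_sym.
  apply: (scalerI (a := (1 - u)%:C)); first by rewrite real_complex_neq0.
  rewrite scalerA -rmorphM mulrA mulfV// mul1r !rmorphB rmorphM rmorph1.
  rewrite !scalerBl scale1r; move: e; rewrite scalerBr subr_eq scalerA => e.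
  by apply/eqP; rewrite subr_eq addrC [X in _ + X]addrC addrA.
- by case: (noSN _ lP).
- by case: (noSN _ lP').
Qed.

Lemma splitting_factor_def (R : realType) (p q : ocycle R) (r : gcycle R) :
  underlying p <> underlying q -> pencil p q r ->
  is_splitting_factor p q r (splitting_factor p q r).
Proof.
move=> pq /(splitting_factor_unique pq)[l [lP _]].
by apply: (xgetPex None); exists l.
Qed.

Lemma elliptic_orientable (R : realType) (r : gcycle R) :
  elliptic r <-> exists p : ocycle R, underlying p = r.
Proof.
split=> [[M Mr M0]|[p <-]]; last first.
  by exists (omx p); [exact: represents_omx|rewrite omx_det oppr_lt0 ltr01].
have [e e0 Me] : exists2 e : R, 0 < e & \det M = - e%:C.
  move: M0; case: (\det M) => a b; rewrite ltcE/= => /andP[/eqP b0 a0].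
  exists (- a); rewrite ?oppr_gt0//; apply/eqP; rewrite eq_complex/= opprK.
  by rewrite -b0 oppr0 !eqxx.
have s0 : (Num.sqrt e)^-1 != 0 by rewrite invr_neq0// gt_eqF// sqrtr_gt0.
have [H HM rH] := represents_scale s0 Mr.
have /andP[Hh _] := hmxP H.
have Hd : \det (hmx H) = -1.
  rewrite HM detZ Me -rmorphXn exprVn sqr_sqrtr ?ltW// mulrN -rmorphM mulVf//.
  by rewrite gt_eqF.
exists (OCycle Hh Hd); apply: (represents_eq (represents_omx _)).
by exists H.
Qed.

(* Main.v *)
Require Import Defs.
From HB Require Import structures.
From mathcomp Require Import all_boot all_order all_algebra.
From mathcomp Require Import boolp classical_sets reals complex.
From mathcomp Require Import sesquilinear ring.

Import GRing.Theory Num.Theory.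

Local Open Scope ring_scope.
Local Open Scope complex_scope.

(** Let A, B, C be the normalized matrices of a, b, c; they are linearly
    independent over R. Write n_a = B - l C, n_b = C - m A, n_c = A - v B. A
    cycle with coordinates (x, y, z) in the basis A, B, C lies in the three
    pencils iff z = - l y, x = - m z and y = - v x, and this system has a nonzero
    solution iff l m v = -1, namely the multiples of (1, - v, l v), which is
    A - v (B - l C). *)

Section GeneralizedCycles.
Set Implicit Arguments.
Unset Strict Implicit.
Variable R : realType.
Implicit Types (M N : 'M[R[i]]_2) (p q r : gcycle R) (x y z : R).

(** * Representatives of generalized cycles and of their pencils *)

Lemma conj_real_complex x : Num.conj x%:C = x%:C.
Proof. by apply/CrealP; rewrite complex_real. Qed.

Lemma represents_neq0 M r : represents M r -> M != 0.
Proof. by case=> H <- _; have /andP[] := hmxP H. Qed.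

Lemma represents_exists M :
  M \is hermsymmx -> M != 0 -> exists r : gcycle R, represents M r.
Proof.
move=> Mh M0; have HP : (M \is hermsymmx) && (M != 0) by rewrite Mh.
by exists (\pi_({eq_quot (@proportional R)}) (HermMx HP))%qT; exists (HermMx HP).
Qed.

Lemma gcycle_represents r : exists M, represents M r.
Proof. by exists (hmx (repr r)); exists (repr r); rewrite ?reprK. Qed.

Lemma represents_comb M N p q x y : represents M p -> represents N q ->
  x%:C *: M + y%:C *: N != 0 ->
  exists r : gcycle R, represents (x%:C *: M + y%:C *: N) r.
Proof.
move=> [H <- _] [K <- _]; apply: represents_exists.
have /andP[+ _] := hmxP H; have /andP[+ _] := hmxP K.
rewrite !qualifE/= !expr0 !scale1r => /eqP Kh /eqP Hh.
apply/eqP/matrixP => j k.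
have /matrixP/(_ j k) := Hh; have /matrixP/(_ j k) := Kh.
by rewrite !mxE => -> ->; rewrite rmorphD !rmorphM/= !conj_real_complex.
Qed.

Lemma pencil_comb M N p q r x y : represents M p -> represents N q ->
  represents (x%:C *: M + y%:C *: N) r -> pencil p q r.
Proof.
move=> Mp Nq xy; exists M, N, x, y; split=> //.
apply: contra_neq (represents_neq0 xy) => -[-> ->].
by rewrite !scale0r addr0.
Qed.

(** A change of representatives only multiplies the two coefficients by real factors, so any fixed
    pair of representatives can be used. *)
Lemma pencilE M N p q r : represents M p -> represents N q -> pencil p q r ->
  exists x y, represents (x%:C *: M + y%:C *: N) r.
Proof.
move=> Mp Nq [M' [N' [x [y [Mp' Nq' _]]]]].
have [s _ ->] := represents_inj Mp' Mp; have [t _ ->] := represents_inj Nq' Nq.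
by rewrite !scalerA -!rmorphM => ?; exists (x * s), (y * t).
Qed.

Lemma pencil_sym p q r : pencil p q r -> pencil q p r.
Proof.
move=> [M [N [x [y [Mp Nq _]]]]]; rewrite addrC; exact: pencil_comb.
Qed.

Lemma pencil_left p q : pencil p q p.
Proof.
have [M Mp] := gcycle_represents p; have [N Nq] := gcycle_represents q.
apply: (@pencil_comb M N _ _ _ 1 0) => //.
by rewrite scale0r addr0 scale1r.
Qed.

Lemma pencil_right p q : pencil p q q.
Proof. exact/pencil_sym/pencil_left. Qed.

(** * Collinearity and linear dependence of matrices *)

Lemma collinear_rot p q r : collinear p q r -> collinear q r p.
Proof. by move=> [u [v [? ? ? ?]]]; exists u, v. Qed.

(** Since [collinear] asks for two distinct spanning cycles, this supplies the second one when all
    three given cycles coincide. *)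
Lemma exists_neq p : exists q : gcycle R, p <> q.
Proof.
(* The matrices diag(1, x) for x = 0 and x = 1 are not proportional, so at least one of the two
   cycles differs from [p]. *)
have H x : exists q : gcycle R,
    represents (\matrix_(j < 2, k < 2)
      (if j == k then if j == 0 then 1 else x%:C else 0)) q.
  apply: represents_exists.
    rewrite qualifE/= expr0 scale1r; apply/eqP/matrixP => j k; rewrite !mxE.
    rewrite [k == j]eq_sym; case: eqP => [->|_]; last by rewrite rmorph0.
    case: ifP => _; first by rewrite rmorph1.
    by rewrite conj_real_complex.
  by apply/eqP => /matrixP/(_ 0 0)/eqP; rewrite !mxE/= oner_eq0.
have [q0 q0P] := H 0; have [q1 q1P] := H 1.
have [pq|] := pselect (p = q0); last by exists q0.
exists q1; rewrite pq => qq; rewrite qq in q0P.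
have [t t0 /matrixP/(_ 1 1)/eqP] := represents_inj q0P q1P.
by rewrite !mxE/= mulr1 eq_sym fmorph_eq0 (negPf t0).
Qed.

Lemma collinear_diag p r : collinear p p r.
Proof.
have [pr|pr] := pselect (p = r); last first.
  by exists p, r; split; [|exact: pencil_left..|exact: pencil_right].
have [q pq] := exists_neq p.
by exists p, q; rewrite -pr; split=> //; exact: pencil_left.
Qed.

Lemma noncollinear_neq p q r :
  ~ collinear p q r -> [/\ p <> q, q <> r & r <> p].
Proof.
move=> npqr; split=> e; apply: npqr; rewrite e.
- exact: collinear_diag.
- by do 2!apply: collinear_rot; exact: collinear_diag.
- by apply: collinear_rot; exact: collinear_diag.
Qed.

(** If [x] were nonzero, the relation could be solved for [omx a], which would put [a] into the
    pencil of [b] and [c]. *)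
Lemma noncollinear_coef0 (a b c : ocycle R) x y z : ~ collinear a b c ->
  x%:C *: omx a + y%:C *: omx b + z%:C *: omx c = 0 -> x = 0.
Proof.
move=> abc e; apply/eqP/negP => /negP x0; apply: abc.
have [ab|ab] := pselect (underlying b = underlying c).
  by rewrite ab; do 2!apply: collinear_rot; exact: collinear_diag.
exists b, c; split=> //; [|exact: pencil_left|exact: pencil_right].
apply: (@pencil_comb (omx b) (omx c) _ _ _ y z); try exact: represents_omx.
have -> : y%:C *: omx b + z%:C *: omx c = (- x)%:C *: omx a.
  by rewrite rmorphN scaleNr; apply/eqP; rewrite -addr_eq0 addrC addrA e.
by apply: represents_scale (represents_omx a); rewrite oppr_eq0.
Qed.

(** Allows coordinates to be compared; the last two equalities follow from the first by rotating the
    cycles. *)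
Lemma noncollinear_free (a b c : ocycle R) x y z x' y' z' :
  ~ collinear a b c ->
  x%:C *: omx a + y%:C *: omx b + z%:C *: omx c =
    x'%:C *: omx a + y'%:C *: omx b + z'%:C *: omx c ->
  [/\ x = x', y = y' & z = z'].
Proof.
move=> abc /eqP; rewrite -subr_eq0 => /eqP e.
have {}e : (x - x')%:C *: omx a + (y - y')%:C *: omx b +
    (z - z')%:C *: omx c = 0.
  by rewrite -e; apply/matrixP => j k; rewrite !mxE; ring.
have bca : ~ collinear b c a by move=> ?; apply: abc; do 2!apply: collinear_rot.
have cab : ~ collinear c a b by move=> ?; apply: abc; apply: collinear_rot.
split; apply/eqP; rewrite -subr_eq0; apply/eqP.
- exact: noncollinear_coef0 e.
- by apply: (noncollinear_coef0 (y := z - z') (z := x - x') bca);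
    rewrite addrC addrA e.
- by apply: (noncollinear_coef0 (y := x - x') (z := y - y') cab);
    rewrite -addrA addrC e.
Qed.

(** * Computing splitting factors from representatives *)

Lemma splitting_factor_Some (p q : ocycle R) r x :
  underlying p <> underlying q -> represents (omx p - x%:C *: omx q) r ->
  splitting_factor p q r = Some x.
Proof.
move=> pq rx; have pqr : pencil p q r.
  apply: (@pencil_comb (omx p) (omx q) _ _ _ 1 (- x)); try exact: represents_omx.
  by rewrite scale1r rmorphN scaleNr.
have [l [_ lu]] := splitting_factor_unique pq pqr.
by rewrite -(lu _ (splitting_factor_def pq pqr)); exact: lu.
Qed.

Lemma splitting_factor_finite (p q : ocycle R) r :
  underlying p <> underlying q -> r <> q -> pencil p q r ->
  exists2 x, splitting_factor p q r = Some x &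
    represents (omx p - x%:C *: omx q) r.
Proof.
move=> pq rq pqr; have := splitting_factor_def pq pqr.
by case: splitting_factor => // x xP; exists x.
Qed.

(** * Concurrency in coordinates *)

Lemma concurrent_cevians (a b c : ocycle R) (na nb nc n : gcycle R) l m v :
  ~ collinear a b c ->
  represents (omx b - l%:C *: omx c) na ->
  represents (omx c - m%:C *: omx a) nb ->
  represents (omx a - v%:C *: omx b) nc ->
  pencil a na n -> pencil b nb n -> pencil c nc n ->
  l * m * v = -1 /\
    represents (omx a - v%:C *: (omx b - l%:C *: omx c)) n.
Proof.
move=> abc rna rnb rnc.
move=> /(pencilE (represents_omx a) rna)[x [y n1]].
move=> /(pencilE (represents_omx b) rnb)[x' [y' n2]].
move=> /(pencilE (represents_omx c) rnc)[w [z n3]].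
have [t _ e12] := represents_inj n1 n2.
have [s _ e13] := represents_inj n1 n3.
(* In the basis A, B, C the cycle [n] has coordinates (x, y, - l y) through [na], which equal t (- m
   y', x', y') through [nb] and s (z, - v z, w) through [nc]. *)
have [xE yE lyE] : [/\ x = - (t * m * y'), y = t * x' & - (l * y) = t * y'].
  apply: (noncollinear_free abc).
  by apply: etrans (etrans _ e12) _; apply/matrixP => j k; rewrite !mxE; ring.
have [xE' yE' _] : [/\ x = s * z, y = - (s * v * z) & - (l * y) = s * w].
  apply: (noncollinear_free abc).
  by apply: etrans (etrans _ e13) _; apply/matrixP => j k; rewrite !mxE; ring.
have yx : y = - (v * x) by rewrite yE' xE'; ring.
(* Otherwise [y] vanishes as well, and the zero matrix would represent [n]. *)
have x0 : x != 0.
  apply: contra_neq (represents_neq0 n1) => x0.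
  by rewrite yx x0 mulr0 oppr0 !scale0r addr0.
split.
  (* The chain x = - m (t y') = m l y = - l m v x, from which [x] is cancelled. *)
  apply: (mulIf x0); rewrite {2}xE.
  have -> : t * m * y' = m * (t * y') by ring.
  by rewrite -lyE yx; ring.
have := represents_scale (invr_neq0 x0) n1.
rewrite yx scalerDr !scalerA -!rmorphM mulVf// scale1r.
by rewrite mulrN mulrCA mulVf// mulr1 rmorphN scaleNr.
Qed.

Lemma cevians_concurrent (a b c : ocycle R) (na nb nc : gcycle R) l m v :
  ~ collinear a b c ->
  represents (omx b - l%:C *: omx c) na ->
  represents (omx c - m%:C *: omx a) nb ->
  represents (omx a - v%:C *: omx b) nc ->
  l * m * v = -1 ->
  concurrent (pencil a na) (pencil b nb) (pencil c nc).
Proof.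
move=> abc rna rnb rnc lmv.
pose P := 1%:C *: omx a + (- v)%:C *: (omx b - l%:C *: omx c).
have PE : P = 1%:C *: omx a + (- v)%:C *: omx b + (v * l)%:C *: omx c.
  by apply/matrixP => j k; rewrite !mxE; ring.
have P0 : P != 0.
  apply/eqP; rewrite PE => /(noncollinear_coef0 abc)/eqP.
  by rewrite oner_eq0.
have [n rn] := represents_comb (represents_omx a) rna P0.
have lmvC : l%:C * m%:C * v%:C = -1 by rewrite -!rmorphM lmv rmorphN.
exists n; split.
- exact: pencil_comb (represents_omx a) rna rn.
- apply: (@pencil_comb _ _ _ _ _ (- v) (v * l) (represents_omx b) rnb).
  rewrite (_ : _ + _ = P)//; rewrite PE; apply/matrixP => j k; rewrite !mxE.
  by ring: lmvC.
- apply: (@pencil_comb _ _ _ _ _ (v * l) 1 (represents_omx c) rnc).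
  rewrite (_ : _ + _ = P)//; rewrite PE; apply/matrixP => j k; rewrite !mxE.
  by ring.
Qed.

End GeneralizedCycles.

Theorem theorem14p1 (R : realType) (a b c : ocycle R) (na nb nc : gcycle R)
  (dab : a <> b) (dac : a <> c) (dbc : b <> c)
  (ncol : ~ collinear a b c)
  (Ga : pencil b c na) (Gb : pencil a c nb) (Gc : pencil a b nc)
  (da : [/\ na <> a, na <> b & na <> c])
  (db : [/\ nb <> a, nb <> b & nb <> c])
  (dc : [/\ nc <> a, nc <> b & nc <> c]) :
  (concurrent (pencil a na) (pencil b nb) (pencil c nc) <->
   pmul (pmul (splitting_factor b c na) (splitting_factor c a nb))
        (splitting_factor a b nc) = Some (-1)) /\
  (forall n : gcycle R,
     pencil a na n -> pencil b nb n -> pencil c nc n ->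
     elliptic na ->
     forall oa : ocycle R, underlying oa = na ->
     splitting_factor a oa n =
     pmul (splitting_factor b oa c) (splitting_factor a b nc)).
Proof.
have [ab bc ca] := noncollinear_neq ncol.
have [na_a na_b na_c] := da; have [nb_a _ _] := db; have [_ nc_b _] := dc.
have [l lE rna] := splitting_factor_finite bc na_c Ga.
(* The factor is taken in the cyclic order (c, a), so the pencil of [a] and [c] is reversed. *)
have [m mE rnb] := splitting_factor_finite ca nb_a (pencil_sym Gb).
have [v vE rnc] := splitting_factor_finite ab nc_b Gc.
rewrite lE mE vE; split.
  split=> [[n [n1 n2 n3]]|[]]; last exact: cevians_concurrent ncol rna rnb rnc.
  by have [/= ->] := concurrent_cevians ncol rna rnb rnc n1 n2 n3.
move=> n n1 n2 n3 _ o oE.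
have [_ rn] := concurrent_cevians ncol rna rnb rnc n1 n2 n3.
have ro : represents (omx o) na by rewrite -oE; exact: represents_omx.
(* With O the matrix of [o], B - l C = t O. Hence B - t O = l C, which represents [c] as soon as l
   is nonzero, and this makes [t] the factor (b, o; c). *)
have [t t0 tE] := represents_inj rna ro.
have -> : splitting_factor b o c = Some t.
  apply: splitting_factor_Some; first by rewrite oE => /esym.
  have l0 : l != 0.
    apply: contra_not_neq na_b => l0; apply: (represents_eq rna).
    by rewrite l0 scale0r subr0; exact: represents_omx.
  by rewrite -tE opprB addrC subrK; exact: represents_scale (represents_omx c).
apply: splitting_factor_Some; first by rewrite oE => /esym.
(* A - v (B - l C), which represents [n], is A - t v O. *)
by rewrite rmorphM [t%:C * _]mulrC -scalerA -tE.
Qed.
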